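(* Let $(\mathcal{A},\tau)$ be a tracial non-commutative probability space with unit ${\bf 1}$, let $P,Q\in\mathcal{A}$ be two orthogonal projections, and let $A:=P-Q$ and $B:={\bf 1}-(P+Q)$ be the associated Kato's dual pair. Then for every integer $j\ge0$, $$\tau[B^{2j+1}]=\tau(B)\qquad\text{and}\qquad \tau[A^{2j+1}]=\tau(A).$$
   Context: A tracial non-commutative probability space $(\mathcal{A},\tau)$ is a unital $*$-algebra $\mathcal{A}$ with unit ${\bf 1}$ together with a state $\tau$ ($\tau({\bf 1})=1$) satisfying $\tau(xy)=\tau(yx)$. An orthogonal projection is an element $P$ with $P=P^\star=P^2$. No freeness or general position assumption is made on $P,Q$. *)

(* Defs.v *)
From HB Require Import structures.
From mathcomp Require Import all_boot all_order all_algebra.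
From mathcomp Require Import reals.
From mathcomp.real_closed Require Import complex.

Set Implicit Arguments.
Unset Strict Implicit.
Unset Printing Implicit Defensive.

Import GRing.Theory Num.Theory.
Local Open Scope ring_scope.

HB.mixin Record Algebra_isStar (C : numClosedFieldType) A
    of GRing.Algebra C A := {
  star : A -> A;
  starK : involutive star;
  starD : {morph star : x y / x + y};
  starZ : forall (a : C) (x : A), star (a *: x) = a^* *: star x;
  starM : forall x y : A, star (x * y) = star y * star x
}.

#[short(type="starAlgType")]
HB.structure Definition StarAlgebra (C : numClosedFieldType) :=
  { A of Algebra_isStar C A & GRing.Algebra C A }.

(* In the order of a [numClosedFieldType], [0 <= z] says that [z] is real and
   nonnegative. *)
Definition is_state (C : numClosedFieldType) (A : starAlgType C)
    (tau : {scalar A}) : Prop :=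
  tau 1 = 1 /\ forall x : A, 0 <= tau (star x * x).

Definition tracial (C : numClosedFieldType) (A : starAlgType C)
    (tau : {scalar A}) : Prop :=
  forall x y : A, tau (x * y) = tau (y * x).

Definition orthogonal_projection (C : numClosedFieldType) (A : starAlgType C)
    (P : A) : Prop :=
  P = star P /\ P = P ^+ 2.

(* Main.v *)
Require Import Defs.
From HB Require Import structures.
From mathcomp Require Import all_boot all_order all_algebra.
From mathcomp Require Import reals.
From mathcomp.real_closed Require Import complex.

(** The dual pair [X = P - Q], [Y = 1 - (P + Q)] of two idempotents satisfies
    [X * Y = - (Y * X)] and [X ^+ 2 + Y ^+ 2 = 1] ([dual_pair_anticomm],
    [dual_pair_sqr]).  These two relations are symmetric in [X] and [Y], and
    together with the trace property they suffice: an odd power of [X] still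
    anticommutes with [Y], so moving one factor [Y] around the trace gives
    [tau (X ^+ (2 * k + 1) * Y ^+ 2) = 0] ([trace_odd_exp_mul_sqr]).  Replacing
    [Y ^+ 2] by [1 - X ^+ 2] shows that consecutive odd moments of [X] agree
    ([trace_odd_exp]).  The same result with [X] and [Y] exchanged gives the
    moments of [Y]. *)

Set Implicit Arguments.
Unset Strict Implicit.
Unset Printing Implicit Defensive.

Import GRing.Theory Num.Theory.
Local Open Scope ring_scope.
Local Open Scope complex_scope.

Section DualPair.
Variables (A : pzRingType) (P Q : A).
Hypotheses (idemP : P = P ^+ 2) (idemQ : Q = Q ^+ 2).

Lemma dual_pair_anticomm :
  (P - Q) * (1 - (P + Q)) = - ((1 - (P + Q)) * (P - Q)).
Proof.
rewrite mulrBr [(1 - _) * _]mulrBl mulr1 mul1r.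
have -> : (P - Q) * (P + Q) = P - Q + (P * Q - Q * P).
  by rewrite mulrBl !mulrDr -!expr2 -idemP -idemQ opprD [- _ - _]addrC addrACA.
have -> : (P + Q) * (P - Q) = P - Q - (P * Q - Q * P).
  by rewrite mulrBr !mulrDl -!expr2 -idemP -idemQ !opprD opprK
             addrACA [Q * P - _]addrC addrACA.
by rewrite opprB opprD addrA subrr [RHS]addrAC subrr.
Qed.

Lemma dual_pair_sqr : (P - Q) ^+ 2 + (1 - (P + Q)) ^+ 2 = 1.
Proof.
have sqA : (P - Q) ^+ 2 = (P + Q) - (P * Q + Q * P).
  rewrite expr2 mulrBr !mulrBl -!expr2 -idemP -idemQ.
  by rewrite opprB addrACA -opprD [Q * P + _]addrC.
have sqS : (P + Q) ^+ 2 = (P + Q) + (P * Q + Q * P).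
  rewrite expr2 mulrDr !mulrDl -!expr2 -idemP -idemQ.
  by rewrite [P * Q + Q]addrC addrACA [Q * P + _]addrC.
have -> : (1 - (P + Q)) ^+ 2 = 1 - (P + Q) - (P + Q) + (P + Q) ^+ 2.
  by rewrite expr2 mulrBr !mulrBl mulr1 !mul1r opprB addrA -expr2 addrAC.
rewrite sqA sqS; set S := P + Q; set T := P * Q + Q * P.
by rewrite [_ - S - S + _]addrA subrK addrACA subrKC addNr addr0.
Qed.

End DualPair.

(** [Y] commutes with [X ^+ 2], so it crosses an odd power of [X] with the same
    sign as it crosses [X]. *)
Lemma anticomm_odd_exp (A : pzRingType) (X Y : A) (k : nat) :
  X * Y = - (Y * X) -> X ^+ k.*2.+1 * Y = - (Y * X ^+ k.*2.+1).
Proof.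
move=> anti.
have commYXX : GRing.comm Y (X ^+ 2).
  by rewrite /GRing.comm expr2 -mulrA anti mulrN !mulrA anti mulNr opprK.
rewrite exprSr -mul2n exprM -mulrA anti mulrN mulrA.
by rewrite -(commrX k commYXX) mulrA.
Qed.

Section TraceOddPowers.
Variables (C : numFieldType) (A : algType C) (tau : {scalar A}).
Hypothesis tauC : forall x y : A, tau (x * y) = tau (y * x).
Variables X Y : A.
Hypothesis anti : X * Y = - (Y * X).

(** The trace equals its own opposite: anticommutation brings one factor [Y] to
    the front at the price of a sign, and cyclicity returns it to the end. *)
Lemma trace_odd_exp_mul_sqr k : tau (X ^+ k.*2.+1 * Y ^+ 2) = 0.
Proof.
have tauN : tau (X ^+ k.*2.+1 * Y ^+ 2) = - tau (X ^+ k.*2.+1 * Y ^+ 2).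
  rewrite [in LHS]expr2 [in LHS]mulrA (anticomm_odd_exp k anti) mulNr raddfN /=.
  by congr (- _); rewrite -[Y * _ * Y]mulrA [LHS]tauC -mulrA.
by apply/eqP; rewrite -eqNr -tauN.
Qed.

Lemma trace_odd_exp j :
  X ^+ 2 + Y ^+ 2 = 1 -> tau (X ^+ (2 * j + 1)) = tau X.
Proof.
move=> sqXY; rewrite mul2n addn1.
elim: j => [|k <-]; first by rewrite expr1.
rewrite doubleS -[in RHS](mulr1 (X ^+ _)) -sqXY mulrDr raddfD /=.
by rewrite trace_odd_exp_mul_sqr addr0 -exprD addn2.
Qed.

End TraceOddPowers.

Theorem mainTheorem5 (R : realType) (A : starAlgType R[i]) (tau : {scalar A})
    (tau_state : is_state tau) (tau_tracial : tracial tau)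
    (P Q : A) (projP : orthogonal_projection P)
    (projQ : orthogonal_projection Q) :
  let KA := P - Q in
  let KB := 1 - (P + Q) in
  forall j : nat,
    tau (KB ^+ (2 * j + 1)%N) = tau KB /\ tau (KA ^+ (2 * j + 1)%N) = tau KA.
Proof.
move=> KA KB j; have [[_ idemP] [_ idemQ]] := (projP, projQ).
have anti : KA * KB = - (KB * KA) by exact: dual_pair_anticomm.
have sqAB : KA ^+ 2 + KB ^+ 2 = 1 by exact: dual_pair_sqr.
split; last exact: trace_odd_exp anti j sqAB.
apply: (trace_odd_exp tau_tracial (Y := KA)); last by rewrite addrC.
by rewrite anti opprK.
Qed.
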